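(* Let $\mathcal C$ be a uniform barrier on $\omega$ of infinite rank. Then there exists a function $g:\mathcal C\to L$, where $L$ is the Kleene–Brouwer order on $\omega^{<\omega}$ (with its order topology), such that for no infinite $A\subseteq\omega$ is the set $g[\mathcal C\restriction A]$ discrete.
   Context: $\omega^{<\omega}$ is the set of finite sequences of natural numbers. The Kleene–Brouwer order on it is: $u\le v$ iff $v\subseteq u$ (i.e. $u$ extends $v$), or else $u,v$ are $\subseteq$-incomparable and $u(k)<v(k)$, where $k=\min\{j:u(j)\neq v(j)\}$. A subset of a topological space is discrete if its subspace topology is discrete. $\mathcal C\restriction A=\{s\in\mathcal C:s\subseteq A\}$. For $a,b\subseteq\omega$, $a\sqsubseteq b$ means $a$ is an initial segment of $b$. A front on an infinite set $M\subseteq\omega$ is a family $\mathcal F\subseteq[M]^{<\omega}$ of finite subsets of $M$ that is a $\sqsubseteq$-antichain and such that every infinite $N\subseteq M$ has an initial segment $s\sqsubseteq N$ with $s\in\mathcal F$. A barrier on $M$ is a front on $M$ which is also a $\subseteq$-antichain. Let $\mathcal T_{\mathcal F}=\{s\in[\omega]^{<\omega}:\exists t\in\mathcal F\ (s\sqsubseteq t)\}$; for a front it has no infinite $\sqsubseteq$-branches. The rank of $s\in\mathcal T_{\mathcal F}$ is defined recursively by $\mathrm{rk}_{\mathcal F}(s)=\sup\{\mathrm{rk}_{\mathcal F}(s\cup\{n\})+1:n\in M,\ n>\max s\ (\text{no restriction on } n \text{ if }s=\emptyset),\ s\cup\{n\}\in\mathcal T_{\mathcal F}\}$ (with $\sup\emptyset=0$),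 and $\mathrm{rk}(\mathcal F)=\mathrm{rk}_{\mathcal F}(\emptyset)$. For $n\in M$, $\mathcal F_{\{n\}}=\{t\setminus\{n\}:\{n\}\sqsubseteq t\in\mathcal F\}$. A front $\mathcal F$ on $M$ of rank $\alpha$ is uniform (recursively on $\alpha$) if one of the following holds: $\alpha=0$ and $\mathcal F=\{\emptyset\}$; $\alpha=\beta+1$ and for every $n\in M$, $\mathcal F_{\{n\}}$ is a uniform front on $M\setminus(n+1)$ of rank $\beta$; $\alpha$ is a limit ordinal and for every $n\in M$, $\mathcal F_{\{n\}}$ is a uniform front on $M\setminus(n+1)$ of some rank $\alpha_n<\alpha$, with $(\alpha_n)_{n\in M}$ strictly increasing and $\sup_{n\in M}\alpha_n=\alpha$. A uniform barrier on $M$ is a uniform front on $M$ which is also a barrier. *)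

(* Defs.v *)
From HB Require Import structures.
From mathcomp Require Import all_boot all_order.
From mathcomp Require Import all_classical topology.
Set Implicit Arguments.
Unset Strict Implicit.
Unset Printing Implicit Defensive.
Import Order.TTheory.
Local Open Scope classical_set_scope.

Definition kbseq : Type := seq nat.
HB.instance Definition _ := Choice.on kbseq.

Definition first_diff (u v : seq nat) : nat :=
  find [pred p | p.1 != p.2] (zip u v).

Definition kb_le (u v : kbseq) : bool :=
  prefix v u ||
  [&& ~~ prefix u v, ~~ prefix v u &
      nth 0 u (first_diff u v) < nth 0 v (first_diff u v)].

Lemma kb_le_nilr u : kb_le u [::].
Proof. by rewrite /kb_le prefix0s. Qed.

Lemma kb_le_nill a v : kb_le [::] (a :: v) = false.
Proof. by rewrite /kb_le prefixs0 prefix0s. Qed.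

Lemma kb_le_cons a u b v :
  kb_le (a :: u) (b :: v) = (a < b) || (a == b) && kb_le u v.
Proof.
rewrite /kb_le !prefix_cons /first_diff /= (eq_sym b a).
by case: (ssrnat.ltngtP a b) => //= h; rewrite ltnNge (ltnW h).
Qed.

Lemma kb_le_refl : reflexive kb_le.
Proof. by elim=> [|a u IH]; rewrite ?kb_le_nilr// kb_le_cons eqxx IH orbT. Qed.

Lemma kb_le_anti : antisymmetric kb_le.
Proof.
elim=> [|a u IH] [|b v] //; rewrite ?kb_le_nill ?andbF //.
rewrite !kb_le_cons; case: ltngtP => //= -> /IH ->//.
Qed.

Lemma kb_le_trans : transitive kb_le.
Proof.
elim=> [|b v IH] [|a u] [|c w]; rewrite ?kb_le_nill ?kb_le_nilr //.
rewrite !kb_le_cons => /orP[ab|/andP[/eqP-> uv]] /orP[bc|/andP[/eqP<- vw]].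
- by rewrite (ltn_trans ab bc).
- by rewrite ab.
- by rewrite bc.
- by rewrite eqxx (IH _ _ uv vw) orbT.
Qed.

Lemma kb_le_total : total kb_le.
Proof.
elim=> [|a u IH] [|b v]; rewrite ?kb_le_nill ?kb_le_nilr //.
by rewrite !kb_le_cons; case: ltngtP => //= _; exact: IH.
Qed.

Fact kb_display : Order.disp_t. Proof. exact: Order.Disp tt tt. Qed.
HB.instance Definition _ := @Order.Le_isPOrder.Build kb_display kbseq
  kb_le kb_le_refl kb_le_anti kb_le_trans.
HB.instance Definition _ := Order.POrder_isTotal.Build kb_display kbseq
  kb_le_total.

Definition KB : orderTopologicalType kb_display := order_topology kbseq.

(** [set_type A] carries the subspace topology. *)
Definition discrete_subset (X : topologicalType) (A : set X) : Prop :=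
  forall U : set (set_type A), open U.

(** [osup f] denotes the supremum of the ordinals [f i + 1]. Distinct terms may
    denote the same ordinal: equality of ordinals is [oeq].
    See [osup_le], [oltNge], [ole_total] and [olt_wf]. *)
Inductive ord : Type := osup (I : Type) (f : I -> ord).

Fixpoint ole (a b : ord) : Prop :=
  match a, b with osup _ f, osup _ g => forall i, exists j, ole (f i) (g j) end.

Definition oeq a b := ole a b /\ ole b a.
Definition ozero : ord := osup (of_void ord).
Definition osucc (a : ord) : ord := osup (fun _ : unit => a).
Definition olt a b := ole (osucc a) b.
Definition oomega : ord := osup (fun n : nat => iter n osucc ozero).

Definition olimit a := ~ oeq a ozero /\ forall b, ~ oeq a (osucc b).

Definition is_osup (A : set ord) (a : ord) :=
  forall b, ole a b <-> forall x, A x -> ole x b.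

Lemma ole_refl a : ole a a.
Proof. by elim: a => I f IH /= i; exists i. Qed.

Lemma ole_trans b a c : ole a b -> ole b c -> ole a c.
Proof.
elim: a b c => I f IH [J g] [K h] /= fg gh i.
have [j fgj] := fg i; have [k ghk] := gh j.
by exists k; exact: IH fgj ghk.
Qed.

Lemma osup_le I (f : I -> ord) b : ole (osup f) b <-> forall i, olt (f i) b.
Proof.
case: b => J g; split=> /= [fg i _|fg i]; first exact: fg.
exact: fg i tt.
Qed.

Lemma oltNge a b : olt a b <-> ~ ole b a.
Proof.
split.
  elim: a b => I f IH [J g] /= ab ba.
  have [j fgj] := ab tt; have [i] := ba j.
  apply: (IH i) => /=; case: (g j) fgj => K h /= fh _.
  exact: fh i.
elim: b a => J g IH [I f] /= nba _.
have /existsNP[j nj] := nba.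
exists j; case gE : (g j) => [K h] /= i.
have := IH j (f i); rewrite gE /= => H.
apply: H (tt) => hf; apply: nj; exists i.
by rewrite gE.
Qed.

Lemma oltW a b : olt a b -> ole a b.
Proof.
elim: a b => I f IH [J g] /= /(_ tt)[j] + i.
case gE : (g j) => [K h] /= /(_ i)[k fh]; exists j.
by rewrite gE; apply: IH => _; exists k.
Qed.

Lemma ole_total a b : ole a b \/ ole b a.
Proof. by have [|/oltNge/oltW] := pselect (ole b a); [right|left]. Qed.

Lemma olt_wf : well_founded olt.
Proof.
move=> a; elim: a => I f IH; constructor=> b /(_ tt)[i bf].
constructor=> c cb; apply: (Acc_inv (IH i)); exact: ole_trans cb bf.
Qed.

Definition initial (a b : set nat) : Prop :=
  a `<=` b /\ forall x y, a x -> b y -> y < x -> a y.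

Definition front (M : set nat) (F : set (set nat)) : Prop :=
  [/\ infinite_set M,
      forall s, F s -> finite_set s /\ s `<=` M,
      forall s t, F s -> F t -> initial s t -> s = t &
      forall N, infinite_set N -> N `<=` M -> exists2 s, F s & initial s N].

Definition barrier (M : set nat) (F : set (set nat)) : Prop :=
  front M F /\ forall s t, F s -> F t -> s `<=` t -> s = t.

Definition tree (F : set (set nat)) : set (set nat) :=
  [set s | finite_set s /\ exists2 t, F t & initial s t].

(** The [n] over which the supremum defining the rank of [s] is taken. *)
Definition ext (M : set nat) (F : set (set nat)) (s : set nat) : set nat :=
  [set n | [/\ M n, forall m, s m -> m < n & tree F (s `|` [set n])]].

Definition child M F (t s : set nat) : Prop :=
  exists n, ext M F s n /\ t = s `|` [set n].

Lemma ext_child M F s (n : {n | ext M F s n}) :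
  child M F (s `|` [set sval n]) s.
Proof. by exists (sval n); split=> //; exact: (svalP n). Qed.

Fixpoint rank_acc M F s (h : Acc (child M F) s) : ord :=
  osup (fun n : {n | ext M F s n} => rank_acc (Acc_inv h (ext_child n))).

(** The default value is never used for fronts, by [front_wf]. *)
Definition rank_at M F s : ord :=
  if pselect (Acc (child M F) s) is left h then rank_acc h else ozero.

Definition rank M F : ord := rank_at M F set0.

Lemma front_wf M F : front M F -> well_founded (child M F).
Proof.
move=> [Minf FM Fanti Fex] s0; apply: contrapT => nacc0.
have step (s : {s | ~ Acc (child M F) s}) :
    {n | ext M F (sval s) n /\ ~ Acc (child M F) (sval s `|` [set n])}.
  apply: cid; apply: contrapT => nex; apply: (svalP s).
  constructor=> t [n [en ->]]; apply: contrapT => nacc; apply: nex.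
  by exists n.
pose next (s : {s | ~ Acc (child M F) s}) : {s | ~ Acc (child M F) s} :=
  exist _ (sval s `|` [set sval (step s)]) (svalP (step s)).2.
pose b k := iter k next (exist _ s0 nacc0).
pose e k := sval (step (b k)).
have eP k : ext M F (sval (b k)) (e k) by exact: (svalP (step (b k))).1.
have bS k : sval (b k.+1) = sval (b k) `|` [set e k] by [].
have b_sub k l : k <= l -> sval (b k) `<=` sval (b l).
  move=> /subnK <-; elim: (l - k) => [//|m IH]; rewrite addSn bS => x bx.
  by left; exact: IH.
have be k : sval (b k.+1) (e k) by rewrite bS; right.
have e_lt k l : k < l -> e k < e l.
  by move=> kl; have [_ + _] := eP l; apply; exact: b_sub kl _ (be k).
have b_tree k : exists2 t, F t & initial (sval (b k.+1)) t.
  by have [_ _ [_]] := eP k.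
pose N := \bigcup_k sval (b k).
have Ne k : N (e k) by exists k.+1.
have cover s : finite_set s -> s `<=` N -> exists k, s `<=` sval (b k).
  move=> /finite_seqP[l ->]; elim: l => [_|x l IH lN]; first by exists 0.
  have [|k lk] := IH; first by move=> y yl; apply: lN => /=; rewrite inE yl orbT.
  have [|j _ xj] := lN x; first by rewrite /= inE eqxx.
  exists (maxn j k) => y /=; rewrite inE => /orP[/eqP->|yl].
    exact: b_sub (leq_maxl _ _) _ xj.
  exact: b_sub (leq_maxr _ _) _ (lk _ yl).
have e_notin k : ~ sval (b k) (e k).
  by move=> bek; have [_ /(_ _ bek)] := eP k; rewrite ltnn.
have Ninf : infinite_set N.
  by move=> /cover/(_ (@subset_refl _ _))[k Nk]; exact: e_notin (Nk _ (Ne k)).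
have NM : N `<=` M.
  move=> x [k _ bx]; have [t Ft [bt _]] := b_tree k.
  by apply: (FM _ Ft).2; apply: bt; exact: b_sub bx.
have [s Fs [sN sNi]] := Fex N Ninf NM.
have [k sk] := cover s (FM _ Fs).1 sN.
have [t Ft [bt bti]] := b_tree k.
suff st : s = t by apply: (e_notin k); apply: sk; rewrite st; exact/bt/be.
apply: Fanti => //; split=> [x sx|x y sx ty yx].
  by apply: bt; exact: b_sub (sk _ sx).
apply: (sNi x) => //; exists k.+1 => //.
by apply: (bti x) => //; exact: b_sub (sk _ sx).
Qed.

Lemma rank_atE M F s : front M F ->
  rank_at M F s =
  osup (fun n : {n | ext M F s n} => rank_at M F (s `|` [set sval n])).
Proof.
move=> /front_wf wfF; rewrite {1}/rank_at.
case: pselect => [[h]|/(_ (wfF s))//] /=.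
congr osup; apply: funext => n; rewrite /rank_at.
by case: pselect => [h'|/(_ (wfF _))//]; congr rank_acc; exact: Prop_irrelevance.
Qed.

Definition front_at (F : set (set nat)) (n : nat) : set (set nat) :=
  [set t `\ n | t in [set t | F t /\ initial [set n] t]].

(** [M `\` [set k | k <= n]] is $M \setminus (n+1)$, as $n+1=\{0,\dots,n\}$. *)
Inductive uniform_front_of_rank
    (M : set nat) (F : set (set nat)) (a : ord) : Prop :=
| Uniform0 of front M F & oeq (rank M F) a & oeq a ozero & F = [set set0]
| UniformS b of front M F & oeq (rank M F) a & oeq a (osucc b) &
    (forall n, M n ->
       uniform_front_of_rank (M `\` [set k | k <= n]) (front_at F n) b)
| UniformLim (c : nat -> ord) of front M F & oeq (rank M F) a & olimit a &
    (forall n, M n ->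
       uniform_front_of_rank (M `\` [set k | k <= n]) (front_at F n) (c n)) &
    (forall n, M n -> olt (c n) a) &
    (forall m n, M m -> M n -> m < n -> olt (c m) (c n)) &
    is_osup [set c n | n in M] a.

Definition uniform_front M F := uniform_front_of_rank M F (rank M F).

Definition uniform_barrier M F := uniform_front M F /\ barrier M F.

(** A set of elements of the type [set_type C], so that it can be mapped along a
    function defined on [C] only. *)
Definition restrict_family (C : set (set nat)) (A : set nat) : set (set_type C) :=
  [set s | set_val s `<=` A].
Arguments restrict_family : clear implicits.

(* Main.v *)
Require Import Defs.
From mathcomp Require Import all_boot all_order.
From mathcomp Require Import interval.
From mathcomp Require Import all_classical topology.
Import Order.TTheory.
Local Open Scope classical_set_scope.

(** The function [g] enumerates the part of [s] after the element at which the
    rank, read along [s], first drops below [oomega]; forgetting that element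
    is what makes the values pile up.

    Suppose that the front has infinite rank, that [A] is infinite, and that
    the ranks of the fronts [front_at F n] are finite for all [n] in [A].  Then
    the rank of the front is a limit, so these ranks strictly increase with
    [n].  A uniform front of finite rank [k] contains all [k]-element subsets
    of its base.  Take [a < b] in [A] with ranks [k < l], and [k] elements of
    [A] above [b], enumerated by [u].  Then [{a} ∪ u] belongs to the front, and
    so does [{b} ∪ u ∪ v] for any [l - k] elements [v] of [A] above [u].  If
    [g] drops the least element and enumerates the rest, then [g] takes the
    value [u] and also values [u ++ m :: w] with [m] arbitrarily large.  In the
    Kleene-Brouwer order [u ++ m :: w] tends to [u] as [m] grows
    ([nbhs_KB_extension]), so [u] is not isolated ([clusters_enum],
    [clusters_not_discrete]).

    In general some [front_at F n] with [n] in [A] may again have infinite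
    rank.  So [g] is built by recursion on the uniform front: on the sets with
    least element [n], use the function already found for [front_at F n] when
    the latter has infinite rank, and drop [n] otherwise.  Since a set with an
    accumulation point in itself stays non-discrete when it is enlarged, a
    single [n] in [A] of infinite rank settles the question for [A]
    ([clusters_split], [uniform_front_clusters]). *)

(** * Finite ordinals *)

Definition onat (k : nat) : ord := iter k osucc ozero.

Lemma olt_onat_omega k : olt (onat k) oomega.
Proof. by move=> _; exists k; exact: ole_refl. Qed.

Lemma ole_osucc {a b} : ole a b -> ole (osucc a) (osucc b).
Proof. by move=> ab _; exists tt. Qed.

Lemma ole0 a : ole ozero a.
Proof. by case: a => I f /= []. Qed.

Lemma ole_onat k l : k <= l -> ole (onat k) (onat l).
Proof.
elim: k l => [|k IH] l; first by move=> _; exact: ole0.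
by case: l => [//|l]; rewrite ltnS => /IH; exact: ole_osucc.
Qed.

Lemma osucc_inj {a b} : oeq (osucc a) (osucc b) -> oeq a b.
Proof. by move=> [/(_ tt)[_ ab] /(_ tt)[_ ba]]. Qed.

Lemma oeq_sym {a b} : oeq a b -> oeq b a.
Proof. by case. Qed.

Lemma oeq_trans {b a c} : oeq a b -> oeq b c -> oeq a c.
Proof.
by move=> [ab ba] [bc cb]; split; [exact: ole_trans bc|exact: ole_trans ba].
Qed.

Lemma osucc_neq0 {a} : ~ oeq (osucc a) ozero.
Proof. by move=> [/(_ tt)[[]]]. Qed.

Lemma not_omega_le {c} : ~ ole oomega c -> exists k, oeq c (onat k).
Proof.
move=> /oltNge/(_ tt)[k]; rewrite -/(onat k).
elim: k => [|k IH] ck; first by exists 0; split=> //; exact: ole0.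
have [/IH//|/oltNge kc] := pselect (ole c (onat k)).
by exists k.+1.
Qed.

(** * Enumerating finite sets of natural numbers *)

Lemma infinite_set_gt {A : set nat} n :
  infinite_set A -> exists2 x, A x & n < x.
Proof.
move=> Ainf; apply: contrapT => nex; apply: Ainf.
apply: (@sub_finite_set _ _ `I_n.+1); last exact: finite_II.
move=> x Ax /=; rewrite ltnS leqNgt; apply/negP => nx.
by apply: nex; exists x.
Qed.

Lemma infinite_setD_le {A : set nat} n :
  infinite_set A -> infinite_set (A `\` [set k | k <= n]).
Proof.
move=> Ainf; apply: infinite_setD => //.
by apply: (@sub_finite_set _ _ `I_n.+1); last exact: finite_II.
Qed.

Lemma infinite_set_path {A : set nat} k n : infinite_set A ->
  exists l : seq nat, [/\ size l = k, path ltn n l & [set` l] `<=` A].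
Proof.
move=> Ainf; elim: k n => [|k IH] n; first by exists [::]; split.
have [x Ax nx] := infinite_set_gt n Ainf; have [l [lk xl lA]] := IH x.
exists (x :: l); split; rewrite /= ?lk ?nx //.
by move=> y /=; rewrite inE => /orP[/eqP->//|]; exact: lA.
Qed.

Definition enum_set (s : set nat) : seq nat :=
  xget [::] [set l | sorted ltn l /\ s = [set` l]].

Lemma enum_set_sorted l : sorted ltn l -> enum_set [set` l] = l.
Proof.
move=> sl; apply: xget_unique => // m [sm lm].
apply: (irr_sorted_eq ltn_trans ltnn) => // x.
apply/idP/idP => xs; first by have : [set` m] x by []; rewrite -lm.
by have : [set` l] x by []; rewrite lm.
Qed.

(** The least element of [s], characterised through [initial] because this is
    how [front_at] refers to it. *)
Definition first (s : set nat) : nat := xget 0 [set n | initial [set n] s].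

Lemma firstE n s : initial [set n] s -> first s = n.
Proof.
move=> ns; apply: xget_unique => // m ms.
have sn : s n by apply: ns.1.
have sm : s m by apply: ms.1.
have [mn|nm|//] := ltngtP m n.
- exact: ns.2 (erefl n) sm mn.
- exact/esym/(ms.2 _ _ (erefl m) sn nm).
Qed.

Lemma path_ltn_gt {n l x} : path ltn n l -> x \in l -> n < x.
Proof. by move=> /(order_path_min ltn_trans)/allP; apply. Qed.

Lemma initial_cons {n l} : path ltn n l -> initial [set n] [set` n :: l].
Proof.
move=> nl; split=> [x /= ->|x y /= -> +]; first by rewrite inE eqxx.
rewrite inE => /orP[/eqP//|/(path_ltn_gt nl) ny yn].
by have := ltn_trans ny yn; rewrite ltnn.
Qed.

Lemma setD1_cons {n l} : path ltn n l -> [set` n :: l] `\ n = [set` l].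
Proof.
move=> nl; apply/seteqP; split=> x /=; rewrite inE.
  by case=> /orP[/eqP//|].
move=> xl; split; first by rewrite xl orbT.
by move=> xn; have := path_ltn_gt nl xl; rewrite xn ltnn.
Qed.

Lemma front_at_cons {F n l} : path ltn n l ->
  front_at F n [set` l] -> F [set` n :: l].
Proof.
move=> nl [t [Ft [nt _]] tl].
suff -> : [set` n :: l] = t by [].
have tn : t n by apply: nt.
apply/seteqP; split=> x /=; rewrite inE.
  move=> /orP[/eqP->//|xl].
  by have : [set` l] x by []; rewrite -tl => -[].
move=> tx; have [->|xn] := eqVneq x n; first by [].
have : (t `\ n) x by split=> //; apply/eqP.
by rewrite tl.
Qed.

(** * Functions on a uniform front whose values cluster *)

(** By induction on [k]: a front of rank [k.+1] is in the successor case of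
    uniformity, so deleting the least element of [l] leaves a set to which the
    induction hypothesis applies in a front of rank [k]. *)
Lemma uniform_front_onat {k M F a l} : uniform_front_of_rank M F a ->
  oeq a (onat k) -> size l = k -> sorted ltn l -> [set` l] `<=` M ->
  F [set` l].
Proof.
elim: k M F a l => [|k IH] M F a l [].
- move=> _ _ _ -> _ /size0nil -> _ _ /=.
  by apply/seteqP; split.
- by move=> b _ _ /oeq_sym ab _ a0; case: (osucc_neq0 (oeq_trans ab a0)).
- by move=> c _ _ [].
- move=> _ _ a0 _ /oeq_sym ka.
  by case: (osucc_neq0 (oeq_trans ka a0)).
- move=> b _ _ /oeq_sym ab Fn ak.
  have bk := osucc_inj (oeq_trans ab ak).
  case: l => [//|n l] [lk] /= nl lM.
  apply: front_at_cons => //.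
  apply: (IH _ _ _ _ (Fn n _) bk lk (path_sorted nl)).
    by apply: lM; rewrite /= inE eqxx.
  move=> x /= xl; split; first by apply: lM; rewrite /= inE xl orbT.
  by move=> /=; rewrite leqNgt (path_ltn_gt nl xl).
- by move=> c _ _ [_ nS] _ _ _ _ /nS.
Qed.

(** A combinatorial witness that [g s] is a limit of other values of [g] on
    members of [F] inside [A]. *)
Definition clusters (F : set (set nat)) (A : set nat)
    (g : set nat -> seq nat) :=
  exists2 s, F s /\ s `<=` A & forall N,
    exists t, [/\ F t, t `<=` A &
      exists m w, N <= m /\ g t = g s ++ m :: w].

(** The sets [{a} ∪ u] and [{b} ∪ u ∪ v] have the images [u] and [u ++ v] when
    their least elements are dropped.  As [k < l], [v] is nonempty, and its
    first element can be chosen beyond any bound. *)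
Lemma clusters_enum {M F A k l a b ra rb} :
  infinite_set A -> A `<=` M -> A a -> A b -> a < b -> k < l ->
  oeq ra (onat k) -> oeq rb (onat l) ->
  uniform_front_of_rank (M `\` [set n | n <= a]) (front_at F a) ra ->
  uniform_front_of_rank (M `\` [set n | n <= b]) (front_at F b) rb ->
  clusters F A (fun s => enum_set (s `\ first s)).
Proof.
move=> Ainf AM Aa Ab ab kl rak rbl Fa Fb.
have FE n i r v : A n ->
    uniform_front_of_rank (M `\` [set m | m <= n]) (front_at F n) r ->
    oeq r (onat i) -> size v = i -> path ltn n v -> [set` v] `<=` A ->
    [/\ F [set` n :: v], [set` n :: v] `<=` A &
      enum_set ([set` n :: v] `\ first [set` n :: v]) = v].
  move=> An Fn ri vi nv vA; split.
  - apply: front_at_cons => //.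
    apply: (uniform_front_onat Fn ri vi (path_sorted nv)) => x xv.
    by split; [exact/AM/vA|rewrite /= leqNgt (path_ltn_gt nv xv)].
  - by move=> x /=; rewrite inE => /orP[/eqP->//|]; exact: vA.
  - rewrite (firstE _ _ (initial_cons nv)) (setD1_cons nv).
    exact: enum_set_sorted (path_sorted nv).
have [u [uk bu uA]] := infinite_set_path k b Ainf.
have au : path ltn a u.
  by case: u bu {uk uA} => //= x u /andP[bx ->]; rewrite (ltn_trans ab bx).
have [Fs sA gs] := FE a k ra u Aa Fa rak uk au uA.
exists [set` a :: u] => // N.
have [v [vk Nv vA]] := infinite_set_path (l - k) (maxn N (last b u)) Ainf.
have buv : path ltn b (u ++ v).
  rewrite cat_path bu; case: v Nv {vk vA} => //= x v /andP[+ ->].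
  by rewrite gtn_max => /andP[_ ->].
have [] := FE b l rb (u ++ v) Ab Fb rbl _ buv _.
- by rewrite size_cat uk vk subnKC // ltnW.
- by move=> x /=; rewrite mem_cat => /orP[/uA|/vA].
move=> Ft tA gt; exists [set` b :: u ++ v]; split => //.
rewrite gs gt; case: v Nv vk {vA buv Ft tA gt} => [_|x v /= /andP[+ _] _].
  by move=> /esym/eqP; rewrite /= subn_eq0 leqNgt kl.
by rewrite gtn_max => /andP[Nx _]; exists x, v; rewrite ltnW.
Qed.

(** Gluing of the functions for the fronts [front_at F n], where [c n] stands for
    the rank of [front_at F n].  The sets [A] that meet the region of infinite
    ranks inherit an accumulation point from one [n] there; on the others the
    glued function is the enumeration of the set without its least element. *)
Lemma clusters_split {M F} {c : nat -> ord} :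
  (forall n, M n -> ole oomega (c n) -> exists g : set nat -> seq nat,
    forall A, infinite_set A -> A `<=` M `\` [set k | k <= n] ->
    clusters (front_at F n) A g) ->
  (forall A, infinite_set A -> A `<=` M ->
    (forall n, A n -> ~ ole oomega (c n)) ->
    clusters F A (fun s => enum_set (s `\ first s))) ->
  exists g : set nat -> seq nat, forall A, infinite_set A -> A `<=` M ->
    clusters F A g.
Proof.
move=> big small.
have /choice[G GP] : forall n, exists g : set nat -> seq nat,
    M n -> ole oomega (c n) ->
    forall A, infinite_set A -> A `<=` M `\` [set k | k <= n] ->
    clusters (front_at F n) A g.
  move=> n; have [[Mn cn]|nn] := pselect (M n /\ ole oomega (c n)).
    by have [g gP] := big n Mn cn; exists g.
  by exists (fun=> [::]) => Mn cn; case: nn.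
(* The first conjunct keeps the default value of [first] at the empty set from
   being taken for an element. *)
pose g s := if pselect (initial [set first s] s /\ ole oomega (c (first s)))
            is left _ then G (first s) (s `\ first s)
            else enum_set (s `\ first s).
exists g => A Ainf AM.
have [[n [An cn]]|nex] := pselect (exists n, A n /\ ole oomega (c n)).
  have lift t : front_at F n t -> t `<=` A `\` [set k | k <= n] ->
      exists t', [/\ F t', t' `<=` A & g t' = G n t].
    move=> [t' [Ft' nt'] <-] tA; exists t'; split=> //.
      move=> x tx; have [->//|/eqP xn] := eqVneq x n.
      by have [] := tA x (conj tx xn).
    by rewrite /g (firstE _ _ nt'); case: pselect => // -[].
  have [|s [Fs sA] sP] := GP n (AM _ An) cn _ (infinite_setD_le n Ainf).
    by apply: setSD.
  have [s' [Fs' s'A gs']] := lift s Fs sA.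
  exists s' => // N; have [t [Ft tA [m [w [Nm Gt]]]]] := sP N.
  have [t' [Ft' t'A gt']] := lift t Ft tA.
  by exists t'; split=> //; exists m, w; rewrite gt' gs'.
have nA n : A n -> ~ ole oomega (c n) by move=> An cn; apply: nex; exists n.
have gE s : s `<=` A -> g s = enum_set (s `\ first s).
  rewrite /g => sA; case: pselect => // -[[ss _] cs].
  by case: (nA (first s)) => //; exact/sA/ss.
have [s [Fs sA] sP] := small A Ainf AM nA.
exists s => // N; have [t [Ft tA [m [w [Nm gt]]]]] := sP N.
by exists t; split=> //; exists m, w; rewrite !gE.
Qed.

(** Only at a limit rank can the ranks of all the fronts [front_at F n], [n] in
    [A], be finite, and there they strictly increase, as [clusters_enum]
    requires. *)
Lemma uniform_front_clusters {M F a} : uniform_front_of_rank M F a ->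
  ole oomega a ->
  exists g : set nat -> seq nat, forall A, infinite_set A -> A `<=` M ->
    clusters F A g.
Proof.
elim=> {M F a} [M F a _ _ a0 _|M F a b _ _ ab _ IH|M F a c _ _ _ Fc IH _ cc _] oa.
- by have /= /(_ 0)[[]] := ole_trans oa a0.1.
- apply: (@clusters_split _ _ (fun=> b)) => // A Ainf _ fin.
  have [n An _] := infinite_set_gt 0 Ainf.
  have [k bk] := not_omega_le (fin n An).
  have /oltNge := olt_onat_omega k.+1; case.
  exact: ole_trans oa (ole_trans ab.1 (ole_osucc bk.1)).
- apply: (@clusters_split _ _ c) => // A Ainf AM fin.
  have [a0 Aa _] := infinite_set_gt 0 Ainf.
  have [b0 Ab ab] := infinite_set_gt a0 Ainf.
  have [k ck] := not_omega_le (fin a0 Aa).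
  have [l cl] := not_omega_le (fin b0 Ab).
  have kl : k < l.
    rewrite ltnNge; apply/negP => lk.
    have /oltNge := cc _ _ (AM _ Aa) (AM _ Ab) ab; apply.
    exact: ole_trans cl.1 (ole_trans (ole_onat _ _ lk) ck.2).
  exact: (clusters_enum Ainf AM Aa Ab ab kl ck cl
    (Fc _ (AM _ Aa)) (Fc _ (AM _ Ab))).
Qed.

(** * Limits in the Kleene-Brouwer order *)

(** An [x] strictly below [u] either extends [u], and then any [m] larger than
    the next entry of [x] will do, or is smaller than [u] at the first
    difference, and then every extension of [u] is above [x]. *)
Lemma kb_gt_extensions {u x} : ~~ kb_le u x ->
  exists N, forall m w, N <= m -> ~~ kb_le (u ++ m :: w) x.
Proof.
elim: u x => [|b u IH] [|a x]; rewrite ?kb_le_nilr //.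
  move=> _; exists a.+1 => m w am.
  by rewrite /= kb_le_cons negb_or -leqNgt (ltnW am) (gtn_eqF am).
rewrite kb_le_cons negb_or -leqNgt => /andP[ab].
have [<- /= /IH[N NP]|ba _] := eqVneq b a.
  by exists N => m w /NP; rewrite /= kb_le_cons ltnn eqxx; apply.
by exists 0 => m w _; rewrite /= kb_le_cons negb_or -leqNgt ab (negbTE ba).
Qed.

Lemma nbhs_KB_extension {u : KB} {U : set KB} : nbhs u U ->
  exists N, forall m w, N <= m -> U (u ++ m :: w).
Proof.
rewrite itv_nbhsE => -[[l r] [io]].
rewrite itv_boundlr => /andP[lu ur] iU.
have below m w : ((u ++ m :: w : KB) <= u)%O.
  by apply/orP; left; exact: prefix_prefix.
have [N NP] : exists N, forall m w, N <= m ->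
    (l <= BLeft (u ++ m :: w : KB))%O.
  case: l io lu {iU} => [[] x|[]] io lu.
  - by case: r io {ur} => [[] y|[]].
  - have : (x < u)%O by []; rewrite ltNge => /kb_gt_extensions[N NP].
    by exists N => m w Nm; rewrite bnd_simp ltNge; exact: NP.
  - by exists 0.
  - by [].
exists N => m w Nm; apply: iU => /=; rewrite itv_boundlr NP //=.
by apply: le_trans ur; rewrite bnd_simp.
Qed.

Lemma clusters_not_discrete {S : set KB} {u : KB} : S u ->
  (forall N, exists m w, N <= m /\ S (u ++ m :: w)) -> ~ discrete_subset S.
Proof.
move=> Su ext disc.
have [V Vo VE] := disc [set exist _ u (mem_set Su)].
have Vu : V u.
  by have : (set_val @^-1` V) (exist _ u (mem_set Su)) by rewrite VE.
have [N NP] := nbhs_KB_extension (open_nbhs_nbhs (conj Vo Vu)).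
have [m [w [Nm Sm]]] := ext N.
have : (set_val @^-1` V) (exist (fun x : KB => x \in S) _ (mem_set Sm)).
  exact: NP.
rewrite VE => /(congr1 (fun x => size (set_val x : seq nat)))/eqP.
by rewrite /= size_cat -[X in _ == X]addn0 eqn_add2l.
Qed.

Theorem proposition3p5 (C : set (set nat))
    (Cuniform : uniform_barrier [set: nat] C)
    (Cinfinite : ole oomega (rank [set: nat] C)) :
  exists g : set_type C -> KB,
    ~ exists A : set nat, infinite_set A /\ discrete_subset (g @` restrict_family C A).
Proof.
have [g gP] := uniform_front_clusters Cuniform.1 Cinfinite.
exists (fun s => g (set_val s)) => -[A [Ainf]].
have [s [Cs sA] sP] := gP A Ainf (@subsetT _ A).
have img t : C t -> t `<=` A ->
    ((fun s : set_type C => g (set_val s) : KB) @` restrict_family C A) (g t).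
  by move=> Ct tA; exists (exist _ t (mem_set Ct)).
apply: clusters_not_discrete (img s Cs sA) _ => N.
have [t [Ct tA [m [w [Nm gt]]]]] := sP N.
by exists m, w; split=> //; rewrite -gt; exact: img.
Qed.
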